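(* There exists a constant $C>0.234$ such that the following holds. Let $n\ge 1$, let $f:\{0,1\}^n\to\{0,1\}$, and denote \[ \mathcal{W}(f)=\frac14\sum_{i=1}^n I_i(f)^2 . \] Then for every $\epsilon\in(0,1]$, \[ \mathcal{S}_\epsilon(f)\le 20\cdot \mathcal{W}(f)^{C\epsilon}. \]
   Context: The cube $\{0,1\}^n$ carries the uniform probability measure $\mu$. For $x\in\{0,1\}^n$, the $\epsilon$-noise perturbation $N_\epsilon(x)$ is the random vector obtained from $x$ by independently keeping each coordinate unchanged with probability $1-\epsilon$ and replacing it by a fresh random value (distributed according to $\mu$ on that coordinate) with probability $\epsilon$. The noise stability is $\mathcal{S}_\epsilon(f)=\mathrm{Cov}_{x\sim\mu,\ y\sim N_\epsilon(x)}[f(x),f(y)]$. The influence of coordinate $i$ is $I_i(f)=\Pr_{x\sim\mu}[f(x)\ne f(x\oplus e_i)]$, where $x\oplus e_i$ is $x$ with the $i$-th coordinate flipped. *)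

(* Defs.v *)
From mathcomp Require Import all_boot all_order all_algebra.
From mathcomp Require Import reals exp.

Set Implicit Arguments.
Unset Strict Implicit.
Unset Printing Implicit Defensive.

Import Order.TTheory GRing.Theory Num.Theory.
Local Open Scope ring_scope.

Section FiniteProbability.
Variables (R : realType) (T : finType).

(* [P] is the probability mass function of a law on the finite type [T]. *)
Definition prob (P : T -> R) (A : pred T) : R := \sum_(t | A t) P t.

Definition expect (P : T -> R) (X : T -> R) : R := \sum_t P t * X t.

Definition cov (P : T -> R) (X Y : T -> R) : R :=
  expect P (fun t => (X t - expect P X) * (Y t - expect P Y)).

Definition unif : T -> R := fun=> #|T|%:R^-1.

End FiniteProbability.

Definition cube (n : nat) := {ffun 'I_n -> bool}.

Definition flip (n : nat) (i : 'I_n) (x : cube n) : cube n :=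
  [ffun j => if j == i then ~~ x j else x j].

Section Noise.
Variables (R : realType) (n : nat).
Implicit Types (eps : R) (x y : cube n) (f : cube n -> bool).

(* One coordinate of the perturbation: the mixture of the point mass at the
   old value [b] (weight [1 - eps]) and of the uniform law (weight [eps]). *)
Definition noise_bit eps (b : bool) : bool -> R :=
  fun b' => (1 - eps) * (b' == b)%:R + eps * unif R b'.

(* The law of N_eps(x): independent coordinates, hence a product of laws. *)
Definition noise eps x : cube n -> R :=
  fun y => \prod_(i < n) noise_bit eps (x i) (y i).

(* The joint law of (x, y) where x is uniform and y ~ N_eps(x). *)
Definition noise_pair eps : cube n * cube n -> R :=
  fun p => unif R p.1 * noise eps p.1 p.2.

Definition noise_stability eps f : R :=
  cov (noise_pair eps) (fun p => (f p.1)%:R) (fun p => (f p.2)%:R).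

Definition influence f (i : 'I_n) : R :=
  prob (@unif R (cube n)) (fun x => f x != f (flip i x)).

Definition W f : R := 4^-1 * \sum_(i < n) influence f i ^+ 2.

End Noise.

(* Main.v *)
(** Put rho = 1 - eps and let c(S) be the Fourier-Walsh coefficients of f, so
that the noise stability is g(rho) = sum_{S <> 0} rho^|S| c(S)^2.  Let
A(rho) = sum |S| rho^|S| c(S)^2 and let m = A(rho) / g(rho) be the mean level.

The function h_i = D_i T_{sqrt rho} f has E|h_i| <= I_i / 2, and
sum_i E h_i^2 = A(rho).  Bonami's (2,4)-inequality, dualised and interpolated
between L1 and L2, gives (E |T_{1/sqrt 3} h_i|^2)^2 <= E h_i^2 (E |h_i|)^2;
summing over i with Cauchy-Schwarz yields A(rho/3)^2 <= A(rho) W.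

Jensen's inequality for the level distribution gives both
g(rho) e^{eps m} <= sum c(S)^2 <= 1 and g(rho) 3^{-m} <= g(rho/3) <= A(rho/3).
Hence g <= e^{-eps m}, and g <= 9^m m W.  The first bound suffices when
m >= C ln (1/W), the second one otherwise. *)

Require Import Defs.
From mathcomp Require Import all_boot all_order all_algebra.
From mathcomp Require Import reals exp.
From mathcomp Require Import sequences ring lra.

Set Implicit Arguments.
Unset Strict Implicit.
Unset Printing Implicit Defensive.

Import Order.TTheory GRing.Theory Num.Theory.
Local Open Scope ring_scope.

(** * Cauchy-Schwarz for finite sums *)

(** The triples with [0 <= x], [0 <= y], [z ^+ 2 <= x * y] are closed under addition. This form
    avoids square roots. *)
Lemma cauchy_schwarz_sum (R : realFieldType) (I : finType) (a b c : I -> R) :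
    (forall i, 0 <= a i) -> (forall i, 0 <= b i) ->
    (forall i, c i ^+ 2 <= a i * b i) ->
  (\sum_i c i) ^+ 2 <= (\sum_i a i) * (\sum_i b i).
Proof.
move=> a0 b0 cab.
suff: [/\ 0 <= \sum_i a i, 0 <= \sum_i b i
        & (\sum_i c i) ^+ 2 <= (\sum_i a i) * (\sum_i b i)] by case.
apply: (big_ind3 (fun x y z : R => [/\ 0 <= x, 0 <= y & z ^+ 2 <= x * y])) => //.
move=> x1 x2 x3 y1 y2 y3 [x10 x20 x3le] [y10 y20 y3le].
split; [exact: addr_ge0|exact: addr_ge0|].
have cross0 : 0 <= x1 * y2 + y1 * x2 by rewrite addr_ge0 // mulr_ge0.
(* AM-GM after squaring: 4 x1 x2 y1 y2 is at most the square of the right-hand side. *)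
have cross : 2 * x3 * y3 <= x1 * y2 + y1 * x2.
  apply: le_trans (ler_norm _) _.
  rewrite -(@ler_pXn2r _ 2) ?nnegrE // real_normK ?num_real //.
  have prod_le : x3 ^+ 2 * y3 ^+ 2 <= (x1 * x2) * (y1 * y2).
    by apply: ler_pM => //; exact: sqr_ge0.
  have := sqr_ge0 (x1 * y2 - y1 * x2); nra.
nra.
Qed.

(** * Expectations on a finite type and Hoelder-type inequalities *)

Section Expectation.
Context {R : realType} {T : finType}.
Implicit Types (F G : T -> R) (P : T -> R).

Lemma eq_expect P F G : F =1 G -> expect P F = expect P G.
Proof. by move=> FG; apply: eq_bigr => x _; rewrite FG. Qed.

Lemma expectD P F G : expect P (fun x => F x + G x) = expect P F + expect P G.
Proof. by rewrite -big_split; apply: eq_bigr => x _; rewrite mulrDr. Qed.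

Lemma expectZ P c F : expect P (fun x => c * F x) = c * expect P F.
Proof. by rewrite /expect mulr_sumr; apply: eq_bigr => x _; rewrite mulrCA. Qed.

Lemma expect_sum P (I : finType) (F : I -> T -> R) :
  expect P (fun x => \sum_i F i x) = \sum_i expect P (F i).
Proof. by rewrite exchange_big; apply: eq_bigr => x _; rewrite mulr_sumr. Qed.

Lemma unif_ge0 (x : T) : 0 <= unif R x.
Proof. by rewrite invr_ge0 ler0n. Qed.

Lemma expect_ge0 P F :
  (forall x, 0 <= P x) -> (forall x, 0 <= F x) -> 0 <= expect P F.
Proof. by move=> P0 F0; apply: sumr_ge0 => x _; rewrite mulr_ge0. Qed.

Lemma le_expect P F G :
  (forall x, 0 <= P x) -> (forall x, F x <= G x) -> expect P F <= expect P G.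
Proof. by move=> P0 FG; apply: ler_sum => x _; rewrite ler_wpM2l. Qed.

Lemma cauchy_schwarz_expect P (a b c : T -> R) :
    (forall x, 0 <= P x) -> (forall x, 0 <= a x) -> (forall x, 0 <= b x) ->
    (forall x, c x ^+ 2 <= a x * b x) ->
  expect P c ^+ 2 <= expect P a * expect P b.
Proof.
move=> P0 a0 b0 cab; apply: cauchy_schwarz_sum => x; try exact: mulr_ge0.
by rewrite exprMn [X in _ <= X]mulrACA -expr2 ler_wpM2l // sqr_ge0.
Qed.

(* Hoelder's inequality with exponents 4 and 4/3, the 4/3-norm being itself
   interpolated between the 1-norm and the 2-norm. *)
Lemma expect_mul_le4 P F G : (forall x, 0 <= P x) ->
  expect P (fun x => F x * G x) ^+ 4 <=
  expect P (fun x => F x ^+ 4) * expect P (fun x => G x ^+ 2)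
    * expect P (fun x => `|G x|) ^+ 2.
Proof.
move=> P0.
have H1 : expect P (fun x => F x * G x) ^+ 2 <=
    expect P (fun x => F x ^+ 2 * `|G x|) * expect P (fun x => `|G x|).
  apply: cauchy_schwarz_expect => // x; first by rewrite mulr_ge0 ?sqr_ge0.
  by rewrite exprMn -mulrA -expr2 real_normK ?num_real.
have H2 : expect P (fun x => F x ^+ 2 * `|G x|) ^+ 2 <=
    expect P (fun x => F x ^+ 4) * expect P (fun x => G x ^+ 2).
  apply: cauchy_schwarz_expect => // x; rewrite ?sqr_ge0 //.
    by rewrite (exprM _ 2 2) sqr_ge0.
  by rewrite exprMn real_normK ?num_real // -exprM.
rewrite (exprM _ 2 2); apply: le_trans (_ : _ <= (_ * _) ^+ 2) _.
  rewrite ler_pXn2r ?nnegrE ?sqr_ge0 //; first exact: H1.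
  by apply: le_trans H1; exact: sqr_ge0.
by rewrite exprMn ler_wpM2r // sqr_ge0.
Qed.

End Expectation.

(** * Fourier-Walsh analysis on the cube *)

Section Fourier.
Context {R : realType} {n : nat}.
Implicit Types (F G : cube n -> R) (x y : cube n) (S U : {set 'I_n}) (r : R).

Local Notation E := (expect (@unif R (cube n))).

Definition chi S x : R := \prod_(i in S) (-1) ^+ x i.

Definition fourier F S : R := E (fun x => F x * chi S x).

(** The operator T_r, indexed by the correlation r = 1 - eps so that level k is multiplied by
    r^k. *)
Definition noise_op r F x : R := \sum_y noise (1 - r) x y * F y.

Lemma unif_cube x : unif R x = \prod_(i < n) 2^-1.
Proof.
by rewrite /unif card_ffun card_bool card_ord prodr_const card_ord natrX exprVn.
Qed.

Lemma chiE S x : chi S x = \prod_i (if i \in S then (-1) ^+ x i else 1).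
Proof. by rewrite /chi big_mkcond. Qed.

(** On one bit the kernel is (1 + r s t) / 2 for the signs s, t of the two bits; expanding the
    product over coordinates gives one term per subset. *)
Lemma noise_fourier r x y :
  noise (1 - r) x y = unif R x * \sum_(S : {set 'I_n}) r ^+ #|S| * chi S x * chi S y.
Proof.
have bitE i : noise_bit (1 - r) (x i) (y i) =
    2^-1 * (r * (-1) ^+ x i * (-1) ^+ y i + 1).
  rewrite /noise_bit /unif card_bool.
  by case: (x i) (y i) => -[]; rewrite /= ?expr0 ?expr1; field.
rewrite /noise (eq_bigr _ (fun i _ => bitE i)) big_split /= -(unif_cube x).
congr (_ * _); rewrite bigA_distr; apply: eq_bigr => S _.
by rewrite -prodr_const /chi -!big_split /= [RHS]big_mkcond.
Qed.

(** The mean factors over coordinates, and a coordinate in exactly one of the two sets contributes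
    0. *)
Lemma expect_chi2 S U : E (fun x => chi S x * chi U x) = (S == U)%:R.
Proof.
rewrite /expect.
under eq_bigr => x _ do rewrite unif_cube !chiE -!big_split /=.
rewrite -(bigA_distr_bigA (fun i (b : bool) => 2^-1 *
  ((if i \in S then (-1) ^+ b else 1) * (if i \in U then (-1) ^+ b else 1)))) /=.
have factorE i : \sum_(b : bool) 2^-1 * ((if i \in S then (-1) ^+ b else 1) *
   (if i \in U then (-1) ^+ b else 1)) = ((i \in S) == (i \in U))%:R :> R.
  rewrite big_bool /=.
  by case: (i \in S) (i \in U) => -[]; rewrite /= ?expr0 ?expr1; field.
rewrite (eq_bigr _ (fun i _ => factorE i)).
have [->|neqSU] := eqVneq S U; first by apply: big1 => i _; rewrite eqxx.
have /existsP[i neqi] : [exists i, (i \in S) != (i \in U)].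
  apply: contraNT neqSU; rewrite negb_exists => /forallP eqSU.
  by apply/eqP/setP => i; apply/eqP; have := eqSU i; rewrite negbK.
by rewrite (bigD1 i) //= (negPf neqi) mul0r.
Qed.

Lemma noise_opE r F x :
  noise_op r F x = \sum_(S : {set 'I_n}) r ^+ #|S| * fourier F S * chi S x.
Proof.
rewrite /noise_op.
under eq_bigr => y _ do rewrite noise_fourier mulr_sumr mulr_suml.
rewrite exchange_big; apply: eq_bigr => S _ /=.
rewrite /fourier /expect mulr_sumr mulr_suml; apply: eq_bigr => y _.
by rewrite !unif_cube; ring.
Qed.

Lemma noise_op1 F x : noise_op 1 F x = F x.
Proof.
rewrite /noise_op (bigD1 x) //= big1 ?addr0 => [|y neqyx].
  rewrite /noise big1 ?mul1r // => i _.
  by rewrite /noise_bit eqxx subrr subr0 mul0r addr0 mulr1.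
have /existsP[i neqi] : [exists i, y i != x i].
  apply: contraNT neqyx; rewrite negb_exists => /forallP eqyx.
  by apply/eqP/ffunP => i; apply/eqP; have := eqyx i; rewrite negbK.
rewrite /noise (bigD1 i) //= /noise_bit (negPf neqi).
by rewrite subrr !(mulr0, mul0r) addr0 !mul0r.
Qed.

(** The kernel expansion at r = 1, where T_r is the identity, so completeness of the characters
    needs no separate argument. *)
Lemma fourier_inversion F x : F x = \sum_(S : {set 'I_n}) fourier F S * chi S x.
Proof.
rewrite -[LHS]noise_op1 noise_opE; apply: eq_bigr => S _.
by rewrite expr1n mul1r.
Qed.

Lemma fourier_sum (c : {set 'I_n} -> R) U :
  fourier (fun x => \sum_(S : {set 'I_n}) c S * chi S x) U = c U.
Proof.
rewrite /fourier.
under eq_expect => x do rewrite mulr_suml.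
rewrite expect_sum (bigD1 U) //= big1 => [|S neqSU].
  under eq_expect => x do rewrite -mulrA.
  by rewrite expectZ expect_chi2 eqxx mulr1 addr0.
under eq_expect => x do rewrite -mulrA.
by rewrite expectZ expect_chi2 (negPf neqSU) mulr0.
Qed.

Lemma fourier_noise_op r F S :
  fourier (noise_op r F) S = r ^+ #|S| * fourier F S.
Proof.
rewrite -(fourier_sum (fun S => r ^+ #|S| * fourier F S)).
by apply: eq_expect => x; rewrite noise_opE.
Qed.

Lemma parseval F G :
  E (fun x => F x * G x) = \sum_(S : {set 'I_n}) fourier F S * fourier G S.
Proof.
under eq_expect => x do rewrite [F x]fourier_inversion mulr_suml.
rewrite expect_sum; apply: eq_bigr => S _.
under eq_expect => x do rewrite -mulrA [chi S x * _]mulrC.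
exact: expectZ.
Qed.

Lemma chi0 x : chi set0 x = 1.
Proof. exact: big_set0. Qed.

Lemma expect_fourier0 F : E F = fourier F set0.
Proof. by apply: eq_expect => x; rewrite chi0 mulr1. Qed.

Lemma expect_cst (c : R) : E (fun=> c) = c.
Proof.
have one : E (fun x => chi set0 x * chi set0 x) = 1.
  by rewrite expect_chi2 eqxx.
rewrite -[RHS]mulr1 -[X in _ = _ * X]one.
by rewrite -expectZ; apply: eq_expect => x; rewrite chi0 !mulr1.
Qed.

Lemma expect_noise_op r F : E (noise_op r F) = E F.
Proof. by rewrite !expect_fourier0 fourier_noise_op cards0 mul1r. Qed.

Lemma noise_ge0 r x y : 0 <= r <= 1 -> 0 <= noise (1 - r) x y.
Proof.
move=> /andP[r0 r1]; apply: prodr_ge0 => i _.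
by rewrite /noise_bit subKr addr_ge0 // mulr_ge0 ?unif_ge0 ?ler0n ?subr_ge0.
Qed.

(** L1-contraction: the kernel is nonnegative and T_r preserves means. *)
Lemma expect_norm_noise_op r F : 0 <= r <= 1 ->
  E (fun x => `|noise_op r F x|) <= E (fun x => `|F x|).
Proof.
move=> r01; rewrite -(expect_noise_op r (fun x => `|F x|)).
apply: le_expect => x; first exact: unif_ge0.
apply: le_trans (ler_norm_sum _ _ _) _; apply: ler_sum => y _.
by rewrite normrM (ger0_norm (noise_ge0 _ _ r01)).
Qed.

(** * Coordinate flips and hypercontractivity *)

Lemma flipK (i : 'I_n) : involutive (flip i).
Proof.
by move=> x; apply/ffunP => j; rewrite !ffunE; case: eqP => // _; rewrite negbK.
Qed.

Lemma expect_flip (i : 'I_n) F : E (fun x => F (flip i x)) = E F.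
Proof.
rewrite [RHS](reindex_inj (inv_inj (@flipK i))).
by apply: eq_bigr => x _; rewrite /unif.
Qed.

Lemma chi_flip (i : 'I_n) S x :
  chi S (flip i x) = if i \in S then - chi S x else chi S x.
Proof.
have off U : i \notin U -> chi U (flip i x) = chi U x.
  move=> iU; apply: eq_bigr => j jU; rewrite ffunE.
  by case: eqP => // ji; rewrite -ji jU in iU.
case: ifPn => [iS|]; last exact: off.
rewrite -(setD1K iS) /chi !big_setU1 ?setD11 //= -/(chi _ _) -/(chi _ _).
rewrite off ?setD11 // ffunE eqxx.
by case: (x i); rewrite /= ?expr0 ?expr1; ring.
Qed.

Lemma sum_setU1 (i : 'I_n) (c : {set 'I_n} -> R) :
  \sum_(S : {set 'I_n}) c S = \sum_(S : {set 'I_n} | i \notin S) (c S + c (i |: S)).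
Proof.
rewrite (bigID (fun S => i \notin S)) big_split /=; congr (_ + _).
rewrite (reindex_onto (fun S => i |: S) (fun S => S :\ i)) /=; last first.
  by move=> S; rewrite negbK => /setD1K.
apply: eq_bigl => S; rewrite setU11 /=.
apply/eqP/idP => [<-|iS]; first by rewrite setD11.
by rewrite setU1K.
Qed.

(* Bonami's lemma.  The induction removes the coordinates one at a time: with
   F = a + (-1)^(x_i) b, averaging over x_i leaves E a^4 + 6 E a^2b^2 + E b^4. *)
Lemma bonami4 (c : {set 'I_n} -> R) :
  E (fun x => (\sum_(S : {set 'I_n}) c S * chi S x) ^+ 4) <=
  (\sum_(S : {set 'I_n}) 3 ^+ #|S| * c S ^+ 2) ^+ 2.
Proof.
(* The dimension stays fixed; the induction is on a list of coordinates containing every set in the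
   support of [c]. *)
have: forall S, c S != 0 -> {subset S <= enum 'I_n}.
  by move=> S _ i _; rewrite mem_enum.
elim: (enum 'I_n) c => [|i s IH] c supp.
  have c0 S : S != set0 -> c S = 0.
    move=> /set0Pn[i iS]; apply/eqP; apply: contraT => /supp /(_ i iS).
    by rewrite in_nil.
  have sumE (d : {set 'I_n} -> R) :
      (forall S, S != set0 -> d S = 0) -> \sum_(S : {set 'I_n}) d S = d set0.
    by move=> d0; rewrite (bigD1 set0) //= big1 ?addr0.
  have FE x : (\sum_(S : {set 'I_n}) c S * chi S x) ^+ 4 = c set0 ^+ 4.
    by rewrite sumE ?chi0 ?mulr1 // => S /c0 ->; rewrite mul0r.
  rewrite (eq_expect _ FE) expect_cst sumE => [|S /c0 ->]; last by rewrite expr2 !mulr0.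
  by rewrite cards0 mul1r -exprM.
pose c1 S := if i \in S then 0 else c S.
pose c2 S := if i \in S then 0 else c (i |: S).
pose a x := \sum_(S : {set 'I_n}) c1 S * chi S x.
pose b x := \sum_(S : {set 'I_n}) c2 S * chi S x.
have supp_tail (d : {set 'I_n} -> R) :
    (forall S, d S != 0 -> i \notin S /\ {subset S <= i :: s}) ->
    forall S, d S != 0 -> {subset S <= s}.
  move=> dsupp S /dsupp[iS Ss] j jS; have := Ss j jS; rewrite inE.
  by case: eqP => // ji; rewrite -ji jS in iS.
have IH1 : E (fun x => a x ^+ 4) <= _ := IH c1 _.
have IH2 : E (fun x => b x ^+ 4) <= _ := IH c2 _.
have {}IH1 := IH1 (supp_tail c1 _); have {}IH2 := IH2 (supp_tail c2 _).
set A := \sum_(S : {set 'I_n}) 3 ^+ #|S| * c1 S ^+ 2 in IH1.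
set B := \sum_(S : {set 'I_n}) 3 ^+ #|S| * c2 S ^+ 2 in IH2.
have {}IH1 : E (fun x => a x ^+ 4) <= A ^+ 2.
  apply: IH1 => S; rewrite /c1; case: ifPn; rewrite ?eqxx // => iS cS.
  by split=> //; exact: supp.
have {}IH2 : E (fun x => b x ^+ 4) <= B ^+ 2.
  apply: IH2 => S; rewrite /c2; case: ifPn; rewrite ?eqxx // => iS cS.
  by split=> // j jS; apply: supp cS _ _; rewrite inE jS orbT.
have A0 : 0 <= A by apply: sumr_ge0 => S _; rewrite mulr_ge0 ?sqr_ge0 ?exprn_ge0.
have B0 : 0 <= B by apply: sumr_ge0 => S _; rewrite mulr_ge0 ?sqr_ge0 ?exprn_ge0.
have FE x : \sum_(S : {set 'I_n}) c S * chi S x = a x + (-1) ^+ x i * b x.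
  rewrite (sum_setU1 i) big_mkcond mulr_sumr -big_split; apply: eq_bigr => S _.
  rewrite /c1 /c2; case: ifPn => [iS|]; last first.
    by rewrite negbK => ->; rewrite /= !mul0r mulr0 addr0.
  by rewrite (negPf iS) {2}/chi big_setU1 //= mulrCA.
have flip_inv (d : {set 'I_n} -> R) x : (forall S, i \in S -> d S = 0) ->
    \sum_(S : {set 'I_n}) d S * chi S (flip i x) =
    \sum_(S : {set 'I_n}) d S * chi S x.
  move=> d0; apply: eq_bigr => S _; rewrite chi_flip.
  by case: ifP => // /d0 ->; rewrite !mul0r.
have a_flip x : a (flip i x) = a x by apply: flip_inv => S iS; rewrite /c1 iS.
have b_flip x : b (flip i x) = b x by apply: flip_inv => S iS; rewrite /c2 iS.
have F4E : E (fun x => (\sum_(S : {set 'I_n}) c S * chi S x) ^+ 4) =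
    E (fun x => a x ^+ 4) + (6 * E (fun x => a x ^+ 2 * b x ^+ 2)
      + E (fun x => b x ^+ 4)).
  rewrite -expectZ -!expectD.
  (* Averaging with the flipped point cancels the odd powers of the sign, since [a] and [b] do not
     depend on coordinate [i]. *)
  have -> (G : cube n -> R) : E G = 2^-1 * (E G + E (fun x => G (flip i x))).
    by rewrite expect_flip; field.
  rewrite -expectD -expectZ.
  apply: eq_expect => x; rewrite !FE a_flip b_flip ffunE eqxx.
  by case: (x i); rewrite /= ?expr0 ?expr1; field.
have mixed : E (fun x => a x ^+ 2 * b x ^+ 2) <= A * B.
  apply: le_trans (ler_norm _) _.
  rewrite -(@ler_pXn2r _ 2) ?nnegrE ?mulr_ge0 // real_normK ?num_real //.
  apply: (@le_trans _ _ (E (fun x => a x ^+ 4) * E (fun x => b x ^+ 4))).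
    apply: cauchy_schwarz_expect => x; rewrite ?unif_ge0 ?exprn_even_ge0 //.
    by rewrite exprMn -!exprM.
  rewrite exprMn; apply: ler_pM => //; apply: expect_ge0 => x;
    by rewrite ?unif_ge0 ?exprn_even_ge0.
(* The factor 3 accounts for the element [i] removed from the sets in [c2]. *)
have -> : \sum_(S : {set 'I_n}) 3 ^+ #|S| * c S ^+ 2 = A + 3 * B.
  rewrite (sum_setU1 i) big_mkcond mulr_sumr -big_split; apply: eq_bigr => S _.
  rewrite /c1 /c2; case: ifPn => [iS|]; last first.
    by rewrite negbK => ->; rewrite /= expr2 !mulr0 addr0.
  by rewrite (negPf iS) cardsU1 iS /= exprD expr1 -mulrA.
(* A^2 + 6AB + B^2 <= (A + 3B)^2. *)
rewrite F4E; nra.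
Qed.

(** With u = T_{1/3} F, the left-hand sum is B = E(uF), and Bonami gives E u^4 <= B^2 because 3^k
    (3^-k)^2 = 3^-k. Hoelder then yields B^4 <= B^2 E F^2 (E |F|)^2, and B^2 cancels. *)
Lemma hypercontractive_interpolation F :
  (\sum_(S : {set 'I_n}) 3^-1 ^+ #|S| * fourier F S ^+ 2) ^+ 2 <=
  E (fun x => F x ^+ 2) * E (fun x => `|F x|) ^+ 2.
Proof.
set B := \sum_(S : {set 'I_n}) _.
pose u := noise_op 3^-1 F.
have uF : E (fun x => u x * F x) = B.
  rewrite parseval; apply: eq_bigr => S _.
  by rewrite fourier_noise_op -mulrA expr2.
have u4 : E (fun x => u x ^+ 4) <= B ^+ 2.
  under eq_expect => x do rewrite /u noise_opE.
  apply: le_trans (bonami4 _) _.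
  rewrite le_eqVlt; apply/orP; left; apply/eqP; congr (_ ^+ 2).
  apply: eq_bigr => S _; rewrite exprMn expr2 !mulrA -exprMn divff ?pnatr_eq0 //.
  by rewrite expr1n mul1r.
have := expect_mul_le4 u F (@unif_ge0 R (cube n)); rewrite uF => B4.
set X := E (fun x => F x ^+ 2) in B4 *; set Y := E (fun x => `|F x|) in B4 *.
have X0 : 0 <= X by apply: expect_ge0 => x; rewrite ?unif_ge0 ?sqr_ge0.
have [->|B0] := eqVneq B 0; first by rewrite expr2 mul0r mulr_ge0 ?sqr_ge0.
have B2 : 0 < B ^+ 2 by rewrite exprn_even_gt0.
rewrite -(ler_pM2l B2) -exprD mulrA; apply: le_trans B4 _.
by apply: ler_wpM2r; [exact: sqr_ge0|exact: ler_wpM2r].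
Qed.

(** The operator D_i: the projection onto the characters whose set contains [i]. *)
Definition half_diff (i : 'I_n) F x : R := 2^-1 * (F x - F (flip i x)).

Lemma fourier_half_diff (i : 'I_n) F S :
  fourier (half_diff i F) S = (i \in S)%:R * fourier F S.
Proof.
rewrite /fourier /half_diff.
rewrite (@eq_expect _ _ _ _ (fun x => 2^-1 * (F x * chi S x) +
  - 2^-1 * (F (flip i x) * chi S x))); last by move=> x; ring.
rewrite expectD !expectZ -[X in _ + _ * X](expect_flip i).
under [X in _ + _ * X]eq_expect => x do rewrite flipK chi_flip.
case: (i \in S) => /=; last by field.
rewrite [X in _ + _ * X](@eq_expect _ _ _ _ (fun x => -1 * (F x * chi S x))); last first.
  by move=> x; ring.
by rewrite expectZ; field.
Qed.

End Fourier.

(** * Boolean functions: influences, level weights and noise stability *)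

Section BooleanFunctions.
Context {R : realType} {n : nat} (f : cube n -> bool).
Implicit Types (S : {set 'I_n}) (rho : R).

Local Notation E := (expect (@unif R (cube n))).
Let fR x : R := (f x)%:R.

(** The quantity A(rho), equal to rho times the derivative of g; the empty set has weight 0. *)
Definition level_weight rho : R :=
  \sum_(S : {set 'I_n}) #|S|%:R * (rho ^+ #|S| * fourier fR S ^+ 2).

(** For a Boolean function, |D_i f| is 1/2 where flipping [i] changes the value and 0 elsewhere. *)
Lemma expect_norm_half_diff (i : 'I_n) :
  E (fun x => `|half_diff i fR x|) = 2^-1 * influence R f i.
Proof.
rewrite /influence /prob big_mkcond mulr_sumr; apply: eq_bigr => x _.
have -> : `|half_diff i fR x| = 2^-1 * (f x != f (flip i x))%:R.
  rewrite /half_diff /fR normrM gtr0_norm ?invr_gt0 //; congr (_ * _).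
  case: (f x) (f (flip i x)) => -[] /=;
    by rewrite ?subrr ?subr0 ?sub0r ?normrN ?normr0 ?normr1.
by rewrite mulrCA; case: ifP; rewrite ?mulr1 ?mulr0.
Qed.

Lemma sum_mem_card (d : {set 'I_n} -> R) :
  \sum_i \sum_(S : {set 'I_n}) (i \in S)%:R * d S =
  \sum_(S : {set 'I_n}) #|S|%:R * d S.
Proof.
rewrite exchange_big; apply: eq_bigr => S _ /=.
rewrite -mulr_suml; congr (_ * _).
rewrite -sum1_card natr_sum [RHS]big_mkcond.
by apply: eq_bigr => i _; case: (i \in S).
Qed.

Lemma level_weight_third rho : 0 <= rho <= 1 ->
  level_weight (3^-1 * rho) ^+ 2 <= level_weight rho * W R f.
Proof.
move=> /andP[rho0 rho1].
(* Squaring the coefficients of T_r D_i f turns r^|S| into rho^|S|. *)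
pose r := Num.sqrt rho.
have r01 : 0 <= r <= 1 by rewrite sqrtr_ge0 -sqrtr1 ler_wsqrtr.
have r2 : r ^+ 2 = rho by rewrite sqr_sqrtr.
pose h i := noise_op r (half_diff i fR).
have h2 i S : fourier (h i) S ^+ 2 =
    (i \in S)%:R * (rho ^+ #|S| * fourier fR S ^+ 2).
  rewrite fourier_noise_op fourier_half_diff !exprMn -r2 -!exprM mulnC.
  by rewrite mulrCA; case: (i \in S); rewrite ?expr1n ?expr0n ?mul1r ?mul0r.
have -> : level_weight (3^-1 * rho) =
    \sum_i \sum_(S : {set 'I_n}) 3^-1 ^+ #|S| * fourier (h i) S ^+ 2.
  rewrite /level_weight -sum_mem_card; apply: eq_bigr => i _; apply: eq_bigr => S _.
  by rewrite h2 exprMn [RHS]mulrCA !mulrA.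
have -> : level_weight rho = \sum_i E (fun x => h i x ^+ 2).
  rewrite /level_weight -sum_mem_card; apply: eq_bigr => i _.
  under [RHS]eq_expect => x do rewrite expr2.
  by rewrite parseval; apply: eq_bigr => S _; rewrite -expr2 h2.
rewrite /W mulr_sumr.
apply: cauchy_schwarz_sum => i.
- by apply: expect_ge0 => x; rewrite ?unif_ge0 ?sqr_ge0.
- by rewrite mulr_ge0 ?sqr_ge0 ?invr_ge0.
apply: le_trans (hypercontractive_interpolation _) _.
apply: ler_wpM2l; first by apply: expect_ge0 => x; rewrite ?unif_ge0 ?sqr_ge0.
(* The factor 1/4 in [W] is the square of the 1/2 in E |D_i f| = I_i / 2. *)
have -> : 4^-1 * influence R f i ^+ 2 = (2^-1 * influence R f i) ^+ 2.
  by field.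
rewrite -expect_norm_half_diff.
rewrite ler_pXn2r // ?nnegrE; last 2 first.
- by apply: expect_ge0 => x; rewrite ?unif_ge0.
- by apply: expect_ge0 => x; rewrite ?unif_ge0.
exact: expect_norm_noise_op.
Qed.

Lemma fourier_cst (c : R) S : fourier (fun=> c) S = c * (S == set0)%:R.
Proof.
rewrite /fourier expectZ eq_sym -(@expect_chi2 R); congr (_ * _).
by apply: eq_expect => x; rewrite chi0 mul1r.
Qed.

Lemma fourier_subc (F : cube n -> R) (c : R) S :
  fourier (fun x => F x - c) S = fourier F S - c * (S == set0)%:R.
Proof.
rewrite -mulNr -fourier_cst /fourier -expectD.
by apply: eq_expect => x; rewrite mulrDl.
Qed.

Lemma expect_noise_pair (eps : R) (F G : cube n -> R) :
  expect (noise_pair eps) (fun p => F p.1 * G p.2) =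
  \sum_(S : {set 'I_n}) (1 - eps) ^+ #|S| * (fourier F S * fourier G S).
Proof.
transitivity (E (fun x => F x * noise_op (1 - eps) G x)); last first.
  rewrite parseval; apply: eq_bigr => S _.
  by rewrite fourier_noise_op mulrCA.
rewrite /expect /noise_pair /noise_op.
rewrite -(pair_bigA_idem _ (fun x y => unif R x * noise eps x y * (F x * G y))) /=.
  apply: eq_bigr => x _; rewrite !mulr_sumr; apply: eq_bigr => y _.
  by rewrite subKr; ring.
by rewrite addr0.
Qed.

(** Both marginal means equal the coefficient at [set0], each obtained by pairing with the constant
    1; centering removes exactly that coefficient. *)
Lemma noise_stability_fourier (eps : R) : noise_stability eps f =
  \sum_(S : {set 'I_n} | S != set0) (1 - eps) ^+ #|S| * fourier fR S ^+ 2.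
Proof.
have cst1 S : fourier (fun=> 1 : R) S = (S == set0)%:R by rewrite fourier_cst mul1r.
have mean1 : expect (noise_pair eps) (fun p => (f p.1)%:R) = fourier fR set0.
  rewrite -[LHS](@eq_expect _ _ _ (fun p => fR p.1 * 1)); last first.
    by move=> p; rewrite mulr1.
  rewrite (expect_noise_pair eps fR (fun=> 1)) (bigD1 set0) //= big1 => [|S S0].
    by rewrite cst1 eqxx cards0 mul1r mulr1 addr0.
  by rewrite cst1 (negPf S0) !mulr0.
have mean2 : expect (noise_pair eps) (fun p => (f p.2)%:R) = fourier fR set0.
  rewrite -[LHS](@eq_expect _ _ _ (fun p => 1 * fR p.2)); last first.
    by move=> p; rewrite mul1r.
  rewrite (expect_noise_pair eps (fun=> 1) fR) (bigD1 set0) //= big1 => [|S S0].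
    by rewrite cst1 eqxx cards0 !mul1r addr0.
  by rewrite cst1 (negPf S0) mul0r mulr0.
rewrite /noise_stability /cov mean1 mean2.
rewrite (expect_noise_pair eps (fun x => fR x - _) (fun x => fR x - _)).
rewrite (bigD1 set0) //= !fourier_subc eqxx mulr1 subrr !mulr0 add0r.
by apply: eq_bigr => S S0; rewrite !fourier_subc (negPf S0) mulr0 subr0 expr2.
Qed.

(** Parseval together with f^2 <= 1. *)
Lemma sum_fourier_sqr_le1 :
  \sum_(S : {set 'I_n} | S != set0) fourier fR S ^+ 2 <= 1.
Proof.
apply: (@le_trans _ _ (\sum_(S : {set 'I_n}) fourier fR S ^+ 2)).
  by rewrite [leRHS](bigD1 set0) //= lerDr sqr_ge0.
under eq_bigr => S _ do rewrite expr2.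
rewrite -parseval -[leRHS](@expect_cst R n).
apply: le_expect => x; first exact: unif_ge0.
by rewrite /fR; case: (f x); rewrite ?mulr1 ?mulr0.
Qed.

End BooleanFunctions.

(** * Exponential estimates *)

(** Jensen with unnormalised weights: bound the exponential below by its tangent at the weighted
    mean m; the linear term averages to 0. *)
Lemma jensen_expR (R : realType) (I : finType) (P : pred I)
    (w k : I -> R) (a : R) :
    (forall i, P i -> 0 <= w i) -> 0 < \sum_(i | P i) w i ->
  (\sum_(i | P i) w i) *
    expR (a * ((\sum_(i | P i) k i * w i) / \sum_(i | P i) w i)) <=
  \sum_(i | P i) w i * expR (a * k i).
Proof.
set g := \sum_(i | P i) w i; set A := \sum_(i | P i) k i * w i.
move=> w0 g0; set m := A / g.
have tangent i : expR (a * m) * (1 + a * (k i - m)) <= expR (a * k i).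
  have -> : a * k i = a * m + a * (k i - m) by ring.
  by rewrite expRD ler_pM2l ?expR_gt0 // expR_ge1Dx.
apply: (@le_trans _ _ (\sum_(i | P i) w i * (expR (a * m) * (1 + a * (k i - m))))).
  rewrite (eq_bigr (fun i => (expR (a * m) * (1 - a * m)) * w i
     + (expR (a * m) * a) * (k i * w i))); last by move=> i _; ring.
  rewrite big_split /= -!mulr_sumr -/g -/A.
  have -> : A = m * g by rewrite /m divfK // gt_eqF.
  by rewrite le_eqVlt; apply/orP; left; apply/eqP; ring.
by apply: ler_sum => i Pi; rewrite ler_wpM2l // w0.
Qed.

(** Allows 3^-m to be replaced by e^(-1.3 m). Here 1.325^4 is about 3.08. *)
Lemma expR_13_ge3 (R : realType) : 3 <= expR (13 / 10 : R).
Proof.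
have -> : 13 / 10 = 4%:R * (13 / 40 : R) by field.
rewrite expRM_natl.
have : 1 + 13 / 40 <= expR (13 / 40 : R) by exact: expR_ge1Dx.
move=> H; apply: le_trans (_ : (1 + 13 / 40) ^+ 4 <= _); first by lra.
by rewrite ler_pXn2r ?nnegrE ?expR_ge0 //; lra.
Qed.

(** * Balancing the two bounds on the noise stability *)

Theorem theorem1p4 (R : realType) :
  exists C : R, 234%:R / 1000%:R < C /\
    forall (n : nat) (f : cube n -> bool), (0 < n)%N ->
    forall eps : R, 0 < eps -> eps <= 1 ->
      noise_stability eps f <= 20%:R * W R f `^ (C * eps).
Proof.
(* The final case requires 3.1 C + C <= 1, that is C <= 10/41, about 0.2439. *)
exists (235 / 1000); split; first by lra.
move=> n f _ eps eps0 eps1.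
have [g0|g0] := leP (noise_stability eps f) 0.
  by apply: le_trans g0 _; rewrite mulr_ge0 ?powR_ge0.
set g := noise_stability eps f in g0 *.
pose c S := fourier (fun x => (f x)%:R : R) S.
have gE : g = \sum_(S : {set 'I_n} | S != set0) (1 - eps) ^+ #|S| * c S ^+ 2.
  exact: noise_stability_fourier.
have rho01 : 0 <= 1 - eps <= 1 by apply/andP; split; lra.
have /andP[rho0 rho1] := rho01.
set A := level_weight f (1 - eps).
have AE : A = \sum_(S : {set 'I_n} | S != set0)
    #|S|%:R * ((1 - eps) ^+ #|S| * c S ^+ 2).
  by rewrite /A /level_weight (bigD1 set0) //= cards0 mul0r add0r.
pose m := A / g.
have A0 : 0 <= A.
  rewrite AE; apply: sumr_ge0 => S _.
  by rewrite mulr_ge0 ?ler0n // mulr_ge0 ?sqr_ge0 ?exprn_ge0.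
have m0 : 0 <= m by rewrite divr_ge0 // ltW.
have jensen a : g * expR (a * m) <= \sum_(S : {set 'I_n} | S != set0)
    ((1 - eps) ^+ #|S| * c S ^+ 2) * expR (a * #|S|%:R).
  rewrite /m AE gE; apply: jensen_expR; last by rewrite -gE.
  by move=> S _; rewrite mulr_ge0 ?sqr_ge0 ?exprn_ge0.
(* Jensen with a = eps, then (1 - eps) e^eps <= 1 on each level. *)
have decay : g * expR (eps * m) <= 1.
  apply: le_trans (jensen eps) _; apply: le_trans (sum_fourier_sqr_le1 f).
  apply: ler_sum => S _; rewrite mulrAC -[leRHS]mul1r ler_wpM2r ?sqr_ge0 //.
  rewrite expRM_natr -exprMn exprn_ile1 ?mulr_ge0 ?expR_ge0 //.
  have := expR_ge1Dx (- eps); rewrite expRN => H.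
  by rewrite -ler_pdivlMr ?expR_gt0 // div1r.
(* Jensen with a = -1.3 and e^(-1.3) <= 1/3; the factor |S| >= 1 is then inserted. *)
have third : g * expR (- (13 / 10) * m) <= level_weight f (3^-1 * (1 - eps)).
  apply: le_trans (jensen _) _.
  rewrite /level_weight [leRHS](bigD1 set0) //= cards0 mul0r add0r.
  apply: ler_sum => S S0; rewrite mulrAC -[leLHS]mul1r.
  apply: ler_pM => //; last 2 first.
  - by rewrite ler1n card_gt0.
  - rewrite ler_wpM2r ?sqr_ge0 // expRM_natr -exprMn lerXn2r ?nnegrE //.
    + by rewrite mulr_ge0 ?expR_ge0.
    + by rewrite mulr_ge0 ?invr_ge0.
    rewrite mulrC ler_wpM2r //.
    by rewrite expRN lef_pV2 ?posrE ?expR_gt0 // expR_13_ge3.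
  by rewrite mulr_ge0 ?sqr_ge0 // mulr_ge0 ?expR_ge0 // exprn_ge0.
(* Squaring [third] gives g^2 e^(-2.6 m) <= A W = m g W; divide by g. *)
have g_le : g <= m * expR (26 / 10 * m) * W R f.
  have : (g * expR (- (13 / 10) * m)) ^+ 2 <= A * W R f.
    apply: le_trans (level_weight_third f rho01).
    by rewrite ler_pXn2r ?nnegrE ?mulr_ge0 ?expR_ge0 ?(ltW g0) //;
      apply: le_trans third; rewrite mulr_ge0 ?expR_ge0 ?(ltW g0).
  have -> : A = m * g by rewrite /m divfK // gt_eqF.
  rewrite exprMn -expRM_natl.
  have -> : 2%:R * (- (13 / 10) * m) = - (26 / 10 * m) by field.
  rewrite expRN ler_pdivrMr ?expR_gt0 // => H.
  by rewrite -(ler_pM2l g0) -expr2; apply: le_trans H _; rewrite le_eqVlt;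
    apply/orP; left; apply/eqP; ring.
(* Absorbs the factor m, raising the rate from 2.6 to 3.1 at the cost of a factor 2. *)
have m_le : m <= 2 * expR (m / 2) by have := expR_ge1Dx (m / 2); lra.
(* If [W] vanished, [g_le] would contradict g > 0; positivity makes the logarithm meaningful. *)
have W0 : 0 < W R f.
  rewrite lt_neqAle; apply/andP; split.
    by apply/negP => /eqP W0; move: g_le; rewrite -W0 mulr0 leNgt g0.
  by rewrite mulr_ge0 ?invr_ge0 // sumr_ge0 // => i _; exact: sqr_ge0.
rewrite /powR gt_eqF //; set l := ln (W R f).
have g_le2 : g <= 2 * expR (31 / 10 * m + l).
  apply: le_trans g_le _; rewrite expRD lnK ?posrE // mulrA ler_wpM2r ?(ltW W0) //.
  have -> : 31 / 10 * m = m / 2 + 26 / 10 * m by field.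
  by rewrite expRD mulrA ler_wpM2r ?expR_ge0.
have g1 : g <= expR (- (eps * m)).
  by rewrite expRN -[leRHS]mul1r ler_pdivlMr ?expR_gt0.
have mono x y : g <= 2 * expR x -> x <= y -> g <= 20 * expR y.
  move=> gx xy; have := expR_gt0 x; have : expR x <= expR y by rewrite ler_expR.
  by move: gx; set u := expR x; set v := expR y; lra.
have g1' : g <= 2 * expR (- (eps * m)).
  by have := expR_gt0 (- (eps * m)); move: g1; set u := expR _; lra.
(* For W >= 1 the target exponent is nonnegative, while -eps m <= 0. *)
have [l0|l0] := leP 0 l.
  apply: mono g1' _; have := mulr_ge0 (ltW eps0) m0.
  by have := mulr_ge0 (ltW eps0) l0; lra.
have [mC|mC] := leP (- (235 / 1000) * l) m.
  by apply: mono g1' _; nra.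
(* Here 3.1 m + l < (1 - 3.1 C) l <= C l <= C eps l, since l < 0 and eps <= 1. *)
by apply: mono g_le2 _; nra.
Qed.
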